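(* Let $R$ be a unital ring. Each element of $R_q^{-1}$ is maximal in the set $R^r$ of von Neumann regular elements of $R$ with respect to the partial ordering $\le$.
   Context: Rings are associative. For elements $x,y$ of a unital ring $R$ write $x\perp y$ if $xRy=0$ and $yRx=0$. An element $u\in R$ is quasi-invertible, written $u\in R_q^{-1}$, if there exist $a,b\in R$ with $(1-ua)\perp(1-bu)$; every quasi-invertible element is von Neumann regular. $R^r$ denotes the set of von Neumann regular elements, i.e. those $a\in R$ with $a=axa$ for some $x\in R$. For $a,b\in R^r$, write $a\le b$ ($b$ extends $a$) if there is $x\in R$ with $a=axb=bxa=axa$; this is a partial order on $R^r$. *)

(* Defs.v *)
From mathcomp Require Import all_boot all_algebra.

Set Implicit Arguments.
Unset Strict Implicit.
Unset Printing Implicit Defensive.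

Import GRing.Theory.
Local Open Scope ring_scope.

Section RingNotions.

(* [pzRingType] rather than [nzRingType]: the zero ring is allowed. *)
Variable R : pzRingType.

Definition orthogonal_elts (x y : R) : Prop :=
  (forall r : R, x * r * y = 0) /\ (forall r : R, y * r * x = 0).

Definition quasi_invertible (u : R) : Prop :=
  exists a b : R, orthogonal_elts (1 - u * a) (1 - b * u).

Definition vn_regular (a : R) : Prop :=
  exists x : R, a = a * x * a.

(* [extended_by a b]: a <= b, i.e. b extends a; only meaningful as an order
   between von Neumann regular elements. *)
Definition extended_by (a b : R) : Prop :=
  exists x : R, [/\ a = a * x * b, a = b * x * a & a = a * x * a].

End RingNotions.

Definition maximal_in (T : Type) (S : T -> Prop) (le : T -> T -> Prop) (m : T)
    : Prop :=
  S m /\ forall b : T, S b -> le m b -> b = m.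

(* Main.v *)
Require Import Defs.
From mathcomp Require Import all_boot all_algebra.

(** Taking the middle factor u in (1 - ua)R(1 - bu) = 0 gives regularity of u.
    If v extends u through x, then 1 - ux and 1 - xu annihilate u on the left
    and on the right, so they absorb 1 - ua and 1 - bu; hence
    v - u = (1 - ux)v(1 - xu) lies in (1 - ux)(1 - ua)R(1 - bu)(1 - xu) = 0. *)

Import GRing.Theory.
Local Open Scope ring_scope.

Lemma quasi_invertible_regular (R : pzRingType) (u : R) :
  quasi_invertible u -> vn_regular u.
Proof.
(* The witness is read off the expansion [(1 - u * a) * u * (1 - b * u) = u - u * (a + b - a * u *
   b) * u]. *)
move=> [a [b [/(_ u) puq0 _]]]; exists (a + b - a * u * b).
apply/eqP; rewrite -subr_eq0 -[X in _ == X]puq0; apply/eqP.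
rewrite !(mulrBl, mulrBr, mulrDl, mulrDr, mul1r, mulr1) !mulrA.
by rewrite !opprD !opprK !addrA.
Qed.

Lemma quasi_invertible_extension_eq (R : pzRingType) (u v : R) :
  quasi_invertible u -> extended_by u v -> v = u.
Proof.
move=> [a [b [puq0 _]]] [x [uxv vxu uxu]].
have absorbl : (1 - u * x) * (1 - u * a) = 1 - u * x.
  by rewrite mulrBr mulr1 mulrA mulrBl mul1r -uxu subrr mul0r subr0.
have absorbr : (1 - b * u) * (1 - x * u) = 1 - x * u.
  by rewrite mulrBl mul1r -mulrA mulrBr mulr1 mulrA -uxu subrr mulr0 subr0.
(* The left factor turns [v] into [v - u] since [u * x * v = u]; the right one changes nothing more,
   as [(v - u) * x * u = u - u = 0]. *)
have corner : (1 - u * x) * v * (1 - x * u) = v - u.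
  by rewrite mulrBl mul1r -uxv mulrBr mulr1 mulrA !mulrBl -vxu -uxu subrr subr0.
(* Undoing both absorptions brings [1 - u * a] and [1 - b * u] next to [v], where orthogonality
   applies with middle factor [v]. *)
apply/eqP; rewrite -subr_eq0 -corner -absorbl -absorbr; apply/eqP.
transitivity ((1 - u * x) * ((1 - u * a) * v * (1 - b * u)) * (1 - x * u)).
  by rewrite !mulrA.
by rewrite puq0 mulr0 mul0r.
Qed.

Theorem proposition2p8 (R : pzRingType) (u : R) (hu : quasi_invertible u) :
  maximal_in (@vn_regular R) (@extended_by R) u.
Proof.
split; first exact: quasi_invertible_regular.
by move=> v _; exact: quasi_invertible_extension_eq.
Qed.
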